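(* Let $Y$ be a Tychonoff space and let $X$ be an arbitrary subspace of $Y$ that is $\tau(\tilde{\mathscr{U}_Y}^{\ast})$-dense in $\tilde{Y}$, where $(\tilde{Y},\tilde{\mathscr{U}_Y})$ is the bicompletion of $(Y,\mathscr{U}_Y)$. If the natural mapping $\hat{e}_{X,Y}: FP(X)\rightarrow FP(Y)$ is a topological monomorphism, then $X$ is quasi-P-embedded in $Y$.
   Context: A paratopological group is a group with a topology for which multiplication is jointly continuous. For a space $X$, the Markov free paratopological group $FP(X)$ is a paratopological group containing $X$ as a subspace such that $X$ generates $FP(X)$ algebraically and each continuous mapping $f:X\to H$ to a paratopological group $H$ extends to a continuous homomorphism $\hat f:FP(X)\to H$; its underlying group is the free group on $X$. For $X\subset Y$, $\hat e_{X,Y}:FP(X)\to FP(Y)$ is the continuous homomorphism (which is a monomorphism) extending the inclusion $e_{X,Y}:X\to Y$. A topological monomorphism is a monomorphism of groups that is also a topological embedding. A quasi-uniformity is defined like a uniformity, with the symmetry axiom dropped. For a quasi-uniformity $\mathscr{U}$ on $X$, $\mathscr{U}^{-1}=\{U^{-1}:U\in\mathscr{U}\}$ with $U^{-1}=\{(y,x):(x,y)\in U\}$; $\mathscr{U}^{\ast}$ is the smallest uniformity on $X$ containing $\mathscr{U}$; $\tau(\mathscr{U})$ is the topology generated by $\mathscr{U}$, in which the sets $\{y:(x,y)\in U\}$, $U\in\mathscr{U}$, form a neighborhood base at $x$. A quasi-uniform space $(X,\mathscr{U})$ is bicomplete if $(X,\mathscr{U}^{\ast})$ is complete; $(\tilde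 X,\tilde{\mathscr{U}})$ denotes the bicompletion of $(X,\mathscr{U})$, i.e. the ($T_0$) bicomplete quasi-uniform space containing $(X,\mathscr{U})$ as a quasi-uniform subspace that is $\tau(\tilde{\mathscr{U}}^{\ast})$-dense. The universal quasi-uniformity $\mathscr{U}_X$ of a space $X$ is the finest quasi-uniformity on $X$ inducing the original topology of $X$. A quasi-pseudometric on $X$ is a function $d:X\times X\to[0,\infty)$ with $d(x,x)=0$ and $d(x,y)\le d(x,z)+d(z,y)$ for all $x,y,z\in X$. $\mathscr{U}^{\star}$ is the upper quasi-uniformity on $\mathbb{R}$ with base the sets $\{(x,y)\in\mathbb{R}\times\mathbb{R}: y<x+r\}$, $r>0$. A quasi-pseudometric $d$ is continuous from $(X\times X,\mathscr{U}_X^{-1}\times\mathscr{U}_X)$ to $(\mathbb{R},\mathscr{U}^{\star})$ if it is continuous with respect to the topologies generated by these quasi-uniformities (the product topology $\tau(\mathscr{U}_X^{-1})\times\tau(\mathscr{U}_X)$ on $X\times X$). A subspace $X$ of a Tychonoff space $Y$ is quasi-P-embedded in $Y$ if each quasi-pseudometric on $X$ that is continuous from $(X\times X,\mathscr{U}_X^{-1}\times\mathscr{U}_X)$ to $(\mathbb{R},\mathscr{U}^{\star})$ extends to a quasi-pseudometric on $Y$ that is continuous from $(Y\times Y,\mathscr{U}_Y^{-1}\times\mathscr{U}_Y)$ to $(\mathbb{R},\mathscr{U}^{\star})$. *)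

(* Defs.v *)
From HB Require Import structures.
From mathcomp Require Import all_boot all_order all_algebra.
From mathcomp Require Import all_classical all_reals all_analysis.
Import Order.TTheory GRing.Theory Num.Theory.
Import numFieldTopology.Exports.

Set Implicit Arguments.
Unset Strict Implicit.
Unset Printing Implicit Defensive.

Local Open Scope classical_set_scope.
Local Open Scope relation_scope.

(* The topology of the domain is the one induced by that of the codomain. *)
Definition topological_embedding (S T : topologicalType) (f : S -> T) : Prop :=
  injective f /\ @open S = [set f @^-1` B | B in @open T].

Definition tychonoff_space (T : topologicalType) : Prop :=
  hausdorff_space T /\ completely_regular_space T.

Lemma diagonal_subset T (A : set (T * T)) :
  (forall x, A (x, x)) -> diagonal `<=` A.
Proof. by move=> Axx [x y]; rewrite /diagonal /= => <-. Qed.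

Record quasiUniformity (T : Type) := QuasiUniformity {
  qent : set_system (T * T);
  qent_filter : Filter qent;
  qent_diagonal : forall A, qent A -> diagonal `<=` A;
  qent_split : forall A, qent A -> exists2 B, qent B & B \; B `<=` A }.

#[global] Hint Extern 0 (Filter (qent _)) => exact: qent_filter
  : typeclass_instances.

Section QuasiUniformity.
Context {T : Type}.
Implicit Types U W : quasiUniformity T.

Definition is_uniformity U : Prop := forall A, qent U A -> qent U A^-1.

Lemma qent_refl U A x : qent U A -> A (x, x).
Proof. by move=> UA; exact: (qent_diagonal UA). Qed.

Section Inverse.
Variable U : quasiUniformity T.

Definition qinv_ent : set_system (T * T) := [set A^-1 | A in qent U].

Lemma qinv_entE A : qinv_ent A <-> qent U A^-1.
Proof.
have invK (B : set (T * T)) : B^-1^-1 = B by apply/seteqP; split=> -[].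
by split=> [[B UB <-]|UA]; [rewrite invK|exists A^-1].
Qed.

Fact qinv_filter : Filter qinv_ent. Proof. exact: filter_inv. Qed.

Fact qinv_diagonal A : qinv_ent A -> diagonal `<=` A.
Proof.
by move=> [B UB <-]; apply: diagonal_subset => x; exact: (qent_refl x UB).
Qed.

Fact qinv_split A : qinv_ent A -> exists2 B, qinv_ent B & B \; B `<=` A.
Proof.
move=> [C UC <-]; have [B UB BC] := qent_split UC.
exists B^-1; first by exists B.
by move=> [x y] /= [z Bzx Byz]; apply: BC; exists z.
Qed.

Definition qu_inv := QuasiUniformity qinv_filter qinv_diagonal qinv_split.

End Inverse.

Section Star.
Variable U : quasiUniformity T.

Definition star_ent : set_system (T * T) :=
  [set A | forall W, is_uniformity W -> qent U `<=` qent W -> qent W A].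

Definition sym_ent : set_system (T * T) :=
  filter_from (qent U) (fun B => B `&` B^-1).

Fact sym_filter : Filter sym_ent.
Proof.
apply: filter_from_filter; first by exists setT; exact: filterT.
move=> A B UA UB; exists (A `&` B); first exact: filterI.
by move=> [x y] /= [[? ?] [? ?]]; split; split.
Qed.

Fact sym_diagonal A : sym_ent A -> diagonal `<=` A.
Proof.
by move=> [B UB BA]; apply: diagonal_subset => x; apply: BA; split;
  exact: (qent_refl x UB).
Qed.

Fact sym_split A : sym_ent A -> exists2 B, sym_ent B & B \; B `<=` A.
Proof.
move=> [C UC CA]; have [B UB BC] := qent_split UC.
exists (B `&` B^-1); first by exists B.
by move=> [x y] /= [z [? ?] [? ?]]; apply: CA; split; apply: BC; exists z.
Qed.

Definition sym_qu := QuasiUniformity sym_filter sym_diagonal sym_split.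

Fact sym_uniformity : is_uniformity sym_qu.
Proof.
move=> A [B UB BA]; exists B => //.
by move=> [x y] /= [? ?]; apply: BA; split.
Qed.

Lemma star_entE A : star_ent A <-> exists2 B, qent U B & B `&` B^-1 `<=` A.
Proof.
split=> [/(_ sym_qu sym_uniformity)|[B UB BA] W uW UW].
  by apply => B UB; exists B => // -[x y] [].
by apply: filterS BA _; apply: filterI; [exact: UW|exact/uW/UW].
Qed.

Fact star_base : star_ent = sym_ent.
Proof. by apply/funext => A; apply/propext; exact: star_entE. Qed.

Fact star_filter : Filter star_ent.
Proof. by rewrite star_base; exact: sym_filter. Qed.

Fact star_diagonal A : star_ent A -> diagonal `<=` A.
Proof. by rewrite star_base; exact: sym_diagonal. Qed.

Fact star_split A : star_ent A -> exists2 B, star_ent B & B \; B `<=` A.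
Proof. by rewrite star_base; exact: sym_split. Qed.

Definition qu_star := QuasiUniformity star_filter star_diagonal star_split.

Lemma qu_star_uniformity : is_uniformity qu_star.
Proof. by move=> A SA W uW UW; exact/uW/SA. Qed.

Lemma qu_star_sub : qent U `<=` qent qu_star.
Proof. by move=> A UA W _; exact. Qed.

End Star.
End QuasiUniformity.

(* [qu_space U] is T with the topology tau(U), and [star_space U] is T with the
   uniformity U^* and the topology tau(U^* ). *)

Definition qu_space (T : Type) (U : quasiUniformity T) : Type := T.

Section QuSpace.
Variables (T : choiceType) (U : quasiUniformity T).

HB.instance Definition _ := Choice.on (qu_space U).
HB.instance Definition _ := hasNbhs.Build (qu_space U) (nbhs_ (qent U)).

Fact qu_nbhs_filter (p : qu_space U) : ProperFilter (nbhs p).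
Proof.
apply: filter_from_proper; last first.
  by move=> A UA; exists p; apply/mem_set; exact: (qent_refl p UA).
apply: filter_from_filter; first by exists setT; exact: filterT.
by move=> A B UA UB; exists (A `&` B); [exact: filterI|rewrite xsectionI].
Qed.

Fact qu_nbhs_singleton (p : qu_space U) (A : set (qu_space U)) :
  nbhs p A -> A p.
Proof. by move=> [B UB]; apply; apply/mem_set; exact: (qent_refl p UB). Qed.

Fact qu_nbhs_nbhs (p : qu_space U) (A : set (qu_space U)) :
  nbhs p A -> nbhs p (nbhs^~ A).
Proof.
move=> [B UB BA]; have [C UC CB] := qent_split UB.
exists C => // q /set_mem Cpq; exists C => // r /set_mem Cqr.
by apply/BA/mem_set/CB; exists q.
Qed.

HB.instance Definition _ := Nbhs_isNbhsTopological.Build (qu_space U)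
  qu_nbhs_filter qu_nbhs_singleton qu_nbhs_nbhs.

End QuSpace.

Definition star_space (T : Type) (U : quasiUniformity T) : Type := T.

HB.instance Definition _ (T : choiceType) (U : quasiUniformity T) :=
  Choice.on (star_space U).
HB.instance Definition _ (T : choiceType) (U : quasiUniformity T) :=
  isUniform.Build (star_space U) (qent_filter (qu_star U))
    (@qent_diagonal _ (qu_star U)) (@qu_star_uniformity _ U)
    (@qent_split _ (qu_star U)).

(* The library's [cvg F] would require a pointed space. *)
Definition bicomplete (T : choiceType) (U : quasiUniformity T) : Prop :=
  forall F : set_system (star_space U), ProperFilter F -> cauchy F ->
    exists x : star_space U, F --> x.

Record is_bicompletion (T : Type) (U : quasiUniformity T)
    (T' : choiceType) (U' : quasiUniformity T') (j : T -> T') : Prop := {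
  bicompletion_inj : injective j;
  bicompletion_trace :
    qent U = [set (fun p => (j p.1, j p.2)) @^-1` B | B in qent U'];
  bicompletion_dense : dense (range j : set (star_space U'));
  bicompletion_T0 : kolmogorov_space (qu_space U');
  bicompletion_bicomplete : bicomplete U' }.

Definition induces (X : topologicalType) (U : quasiUniformity X) : Prop :=
  @open (qu_space U) = @open X.

Section Universal.
Variable X : topologicalType.
Implicit Types U V W : quasiUniformity X.

Lemma inducesP U : induces U <-> forall x : X, nbhs_ (qent U) x = nbhs x.
Proof.
split=> [UX x|UX].
  rewrite -[LHS]/(@nbhs _ (qu_space U) x) (@nbhsE (qu_space U)) (@nbhsE X).
  by rewrite /open_nbhs UX.
rewrite /induces [LHS]openE [RHS]openE /interior /=.
apply/seteqP; split=> A /= sA x Ax; have := sA x Ax.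
  by rewrite -UX.
by rewrite -[X in _ -> X]/(nbhs_ (qent U) x A) UX.
Qed.

Definition pervin_rel (s : seq (set X)) : set (X * X) :=
  [set p | forall O, O \in s -> O p.1 -> O p.2].

Definition pervin_ent : set_system (X * X) :=
  filter_from [set s | forall O, O \in s -> open O] pervin_rel.

Fact pervin_filter : Filter pervin_ent.
Proof.
apply: filter_from_filter; first by exists [::].
move=> s t os ot; exists (s ++ t).
  by move=> O; rewrite mem_cat => /orP[/os|/ot].
by move=> p st; split=> O Os; apply: st; rewrite // mem_cat Os ?orbT.
Qed.

Fact pervin_diagonal A : pervin_ent A -> diagonal `<=` A.
Proof. by move=> [s _ sA]; apply: diagonal_subset => x; apply: sA => O. Qed.

Fact pervin_split A : pervin_ent A -> exists2 B, pervin_ent B & B \; B `<=` A.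
Proof.
move=> [s os sA]; exists (pervin_rel s); first by exists s.
by move=> [x y] /= [z xz zy]; apply: sA => O sO /(xz _ sO)/(zy _ sO).
Qed.

Definition qu_pervin :=
  QuasiUniformity pervin_filter pervin_diagonal pervin_split.

Fact pervin_induces : induces qu_pervin.
Proof.
apply/inducesP => x; apply/seteqP; split=> A.
  move=> [B [s os sB] BA]; apply: filterS BA _.
  suff : nbhs x (fun y => pervin_rel s (x, y)).
    by apply: filterS => y xy; apply/mem_set/sB.
  elim: s os {sB} => [_|O s IH os]; first by apply: nearW => y P.
  have {IH} sx : nbhs x (fun y => pervin_rel s (x, y)).
    by apply: IH => P sP; apply: os; rewrite inE sP orbT.
  have Ox : nbhs x (fun y => O x -> O y).
    have [Ox|nOx] := pselect (O x); last by apply: nearW.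
    apply: filterS (open_nbhs_nbhs (conj (os O (mem_head _ _)) Ox)) => y Oy _.
    exact: Oy.
  near=> y => P; rewrite inE => /predU1P[->|]; first by near: y.
  by move: P; near: y.
rewrite nbhsE => -[B [oB Bx] BA]; exists (pervin_rel [:: B]).
  by exists [:: B] => // P; rewrite /= inE => /eqP ->.
by move=> y /set_mem xy; apply/BA/(xy B); rewrite ?mem_head.
Unshelve. all: by end_near. Qed.

Section Meet.
Variables V W : quasiUniformity X.

Definition meet_ent : set_system (X * X) :=
  filter_from (qent V `*` qent W) (fun p => p.1 `&` p.2).

Fact meet_filter : Filter meet_ent.
Proof.
apply: filter_from_filter; first by exists (setT, setT); split; exact: filterT.
move=> [A B] [A' B'] [/= VA WB] [/= VA' WB'].
exists (A `&` A', B `&` B'); first by split; exact: filterI.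
by move=> p /= [[? ?] [? ?]].
Qed.

Fact meet_diagonal A : meet_ent A -> diagonal `<=` A.
Proof.
move=> [[B C] [/= VB WC] BCA]; apply: diagonal_subset => x.
by apply: BCA; split; [exact: (qent_refl x VB)|exact: (qent_refl x WC)].
Qed.

Fact meet_split A : meet_ent A -> exists2 B, meet_ent B & B \; B `<=` A.
Proof.
move=> [[B C] [/= VB WC] BCA].
have [B' VB' B'B] := qent_split VB; have [C' WC' C'C] := qent_split WC.
exists (B' `&` C'); first by exists (B', C').
by move=> [x y] /= [z [? ?] [? ?]]; apply: BCA; split;
  [apply: B'B|apply: C'C]; exists z.
Qed.

Definition qu_meet := QuasiUniformity meet_filter meet_diagonal meet_split.

Lemma induces_meet : induces V -> induces W -> exists2 M, induces M &
  forall A B, qent V A -> qent W B -> qent M (A `&` B).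
Proof.
move=> /inducesP Vx /inducesP Wx; exists qu_meet; last first.
  by move=> A B VA WB; exists (A, B).
apply/inducesP => x; apply/seteqP; split=> A.
  move=> [B [[C D] [/= VC WD] CDB] BA].
  have Cx : nbhs x (xsection C x) by rewrite -Vx; exists C.
  have Dx : nbhs x (xsection D x) by rewrite -Wx; exists D.
  apply: filterS (filterI Cx Dx) => y [/set_mem Cy /set_mem Dy].
  by apply/BA/mem_set/CDB.
rewrite -Vx => -[B VB BA]; exists B => //.
by exists (B, setT); [split=> //; exact: filterT|move=> p []].
Qed.

End Meet.

(* The union of all the quasi-uniformities inducing the topology: it is itself
   one of them by [universal_qu_induces], hence the finest. *)
Definition universal_ent : set_system (X * X) :=
  [set A | exists2 V : quasiUniformity X, induces V & qent V A].

Fact universal_filter : Filter universal_ent.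
Proof.
split=> [|A B [V iV VA] [W iW WB]|A B AB [V iV VA]].
- by exists qu_pervin; [exact: pervin_induces|exact: filterT].
- by have [M iM MAB] := induces_meet iV iW; exists M => //; exact: MAB.
- by exists V => //; exact: filterS VA.
Qed.

Fact universal_diagonal A : universal_ent A -> diagonal `<=` A.
Proof. by move=> [V _]; exact: qent_diagonal. Qed.

Fact universal_split A :
  universal_ent A -> exists2 B, universal_ent B & B \; B `<=` A.
Proof.
by move=> [V iV /qent_split[B VB BA]]; exists B => //; exists V.
Qed.

Definition universal_qu :=
  QuasiUniformity universal_filter universal_diagonal universal_split.

Lemma universal_qu_induces : induces universal_qu.
Proof.
apply/inducesP => x; apply/seteqP; split=> A.
  by move=> [B [V /inducesP Vx VB] BA]; rewrite -Vx; exists B.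
have /inducesP <- := pervin_induces.
move=> [B PB BA]; exists B => //; exists qu_pervin => //.
exact: pervin_induces.
Qed.

Lemma universal_qu_finest V : induces V -> qent V `<=` qent universal_qu.
Proof. by move=> iV A VA; exists V. Qed.

End Universal.

Section Upper.
Local Open Scope ring_scope.
Variable R : realType.

Definition upper_ent : set_system (R * R) :=
  filter_from [set r : R | 0 < r] (fun r => [set p | p.2 < p.1 + r]).

Fact upper_filter : Filter upper_ent.
Proof.
apply: filter_from_filter; first by exists 1; exact: ltr01.
move=> r s r0 s0; exists (Num.min r s); first by rewrite /= lt_min r0.
by move=> p /=; rewrite -!ltrBlDl lt_min => /andP[].
Qed.

Fact upper_diagonal A : upper_ent A -> diagonal `<=` A.
Proof.
by move=> [r r0 rA]; apply: diagonal_subset => x; apply: rA; rewrite /= ltrDl.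
Qed.

Fact upper_split A : upper_ent A -> exists2 B, upper_ent B & B \; B `<=` A.
Proof.
move=> [r r0 rA]; exists [set p | p.2 < p.1 + r / 2].
  by exists (r / 2) => //=; rewrite divr_gt0.
move=> [x y] /= [z /= xz zy]; apply: rA => /=.
by rewrite (splitr r) addrA; apply: lt_trans zy _; rewrite ltrD2r.
Qed.

Definition upper_qu : quasiUniformity R :=
  QuasiUniformity upper_filter upper_diagonal upper_split.

Record is_quasi_pseudometric (T : Type) (d : T -> T -> R) : Prop := {
  qpm_ge0 : forall x y, 0 <= d x y;
  qpm_refl : forall x, d x x = 0;
  qpm_triangle : forall x y z, d x y <= d x z + d z y }.

Definition qpm_continuous (X : topologicalType) (d : X -> X -> R) : Prop :=
  continuous (fun p : qu_space (qu_inv (universal_qu X)) *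
                      qu_space (universal_qu X) =>
                d p.1 p.2 : qu_space upper_qu).

Definition quasi_P_embedded (Y : topologicalType) (X : set Y) : Prop :=
  forall d : X -> X -> R, is_quasi_pseudometric d -> qpm_continuous d ->
    exists D : Y -> Y -> R,
      [/\ is_quasi_pseudometric D, qpm_continuous D &
          forall x y : X, D (set_val x) (set_val y) = d x y].

End Upper.

HB.mixin Record isParatopologicalGroup G of Group G & Topological G := {
  mulg_continuous : continuous (fun p : G * G => (p.1 * p.2)%g) }.

#[short(type="paratopologicalGroupType")]
HB.structure Definition ParatopologicalGroup :=
  {G of Group G & Topological G & isParatopologicalGroup G}.

Definition continuous_hom (G H : paratopologicalGroupType) (f : G -> H) :
    Prop :=
  {morph f : x y / (x * y)%g} /\ continuous f.

Definition generates (G : groupType) (A : set G) : Prop :=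
  forall S : set G, A `<=` S -> S 1%g ->
    (forall x y, S x -> S y -> S (x * y)%g) ->
    (forall x, S x -> S (x^-1)%g) -> S = setT.

(* The Markov free paratopological group FP(X), given by its defining
   properties, which determine it up to topological isomorphism over X. *)
Record freeParatopologicalGroup (X : topologicalType) :=
  FreeParatopologicalGroup {
  fp_group :> paratopologicalGroupType;
  fp_in : X -> fp_group;
  fp_in_embedding : topological_embedding fp_in;
  fp_generates : generates (range fp_in);
  fp_extends : forall (H : paratopologicalGroupType) (f : X -> H),
    continuous f ->
    exists2 g : fp_group -> H, continuous_hom g & forall x, g (fp_in x) = f x }.

(* The homomorphism FP(X) -> FP(Y) extending the inclusion X -> Y; it is unique
   since X generates FP(X). *)
Definition is_natural_map (Y : topologicalType) (X : set Y)
    (FX : freeParatopologicalGroup X) (FY : freeParatopologicalGroup Y)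
    (e : FX -> FY) : Prop :=
  continuous_hom e /\ forall x : X, e (fp_in FX x) = fp_in FY (set_val x).

Definition topological_monomorphism (G H : paratopologicalGroupType)
    (f : G -> H) : Prop :=
  {morph f : x y / (x * y)%g} /\ topological_embedding f.

(* Main.v *)
(** Let [d] be a quasi-pseudometric on [X] with the required continuity.  The
    Kuratowski map [x |-> d(., x)] is continuous into the additive group of real
    functions on [X] with the one-sided topology of uniform convergence, a
    paratopological group, and [d(x, y)] is the supremum of [d(., y) - d(., x)].
    Extending it to [FP(X)] gives a neighbourhood [N] of 1 such that
    [x^-1 y \in N] implies [d(x, y) < r].  As [FP(X)] embeds in [FP(Y)], [N]
    contains the trace of a neighbourhood [M] of 1 in [FP(Y)], and the relation
    [y^-1 y' \in M] belongs to the universal quasi-uniformity of [Y].  Hence [d]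
    is quasi-uniformly continuous for the trace on [X] of that quasi-uniformity,
    and it extends to [Y] because [X] is dense in [Y] for the associated
    uniformity. *)
Require Import Defs.
From HB Require Import structures.
From mathcomp Require Import all_boot all_order all_algebra.
From mathcomp Require Import all_classical all_reals all_analysis.
From mathcomp Require Import lra.
Import Order.TTheory GRing.Theory Num.Theory.

Set Implicit Arguments.
Unset Strict Implicit.
Unset Printing Implicit Defensive.

Local Open Scope classical_set_scope.
Local Open Scope relation_scope.
Local Open Scope ring_scope.

(** * Entourages of the universal quasi-uniformity *)

Lemma qent_universal (X : topologicalType) (U : quasiUniformity X) :
  (forall A (x : X), qent U A -> nbhs x (xsection A x)) ->
  qent U `<=` qent (universal_qu X).
Proof.
(* [U] alone may induce a strictly coarser topology; its meet with the Pervin quasi-uniformity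
   induces exactly that of [X]. *)
move=> Unbhs A UA; exists (qu_meet U (qu_pervin X)); last first.
  by exists (A, setT) => [|p []//]; split=> //; exact: filterT.
have /inducesP PX := pervin_induces X.
apply/inducesP => x; apply/seteqP; split=> [B [C [[V P] /= [UV PP] VPC] CB]|B].
  have xP : nbhs x (xsection P x) by rewrite -PX; exists P.
  apply: filterS (filterI (Unbhs V x UV) xP) => y.
  by move=> [/set_mem Vxy /set_mem Pxy]; apply/CB/mem_set/VPC.
rewrite -PX => -[P PP PB]; exists P => //.
by exists (setT, P) => [|p []//]; split=> //; exact: filterT.
Qed.

(** * The left quasi-uniformity of a paratopological group and its pullbacks *)

Section LeftQuasiUniformity.
Local Open Scope group_scope.
Variable G : paratopologicalGroupType.

Definition left_ent : set_system (G * G) :=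
  filter_from (nbhs 1) (fun N => [set p | N (p.1^-1 * p.2)]).

Fact left_filter : Filter left_ent.
Proof.
apply: filter_from_filter; first by exists setT; exact: filterT.
by move=> M N M1 N1; exists (M `&` N) => //; exact: filterI.
Qed.

Fact left_diagonal A : left_ent A -> diagonal `<=` A.
Proof.
move=> [N N1 NA]; apply: diagonal_subset => x; apply: NA => /=.
by rewrite mulVg; exact: nbhs_singleton.
Qed.

Fact left_split A : left_ent A -> exists2 B, left_ent B & B \; B `<=` A.
Proof.
move=> [N N1 NA].
have [[P Q] /= [P1 Q1] PQN] : nbhs ((1, 1) : G * G) [set p | N (p.1 * p.2)].
  by apply: mulg_continuous => /=; rewrite mulg1.
exists [set p | (P `&` Q) (p.1^-1 * p.2)].
  by exists (P `&` Q) => //; exact: filterI.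
move=> [x y] /= [z [Pxz _] [_ Qzy]]; apply: NA => /=.
have := PQN (x^-1 * z, z^-1 * y) (conj Pxz Qzy).
by rewrite /= mulgA mulgK.
Qed.

Definition left_qu := QuasiUniformity left_filter left_diagonal left_split.

End LeftQuasiUniformity.

Section Pullback.
Variables (S T : Type) (f : S -> T) (U : quasiUniformity T).

Definition pullback_ent : set_system (S * S) :=
  filter_from (qent U) (fun A => [set p | A (f p.1, f p.2)]).

Fact pullback_filter : Filter pullback_ent.
Proof.
apply: filter_from_filter; first by exists setT; exact: filterT.
by move=> A B UA UB; exists (A `&` B) => //; exact: filterI.
Qed.

Fact pullback_diagonal A : pullback_ent A -> diagonal `<=` A.
Proof.
move=> [B UB BA]; apply: diagonal_subset => x; apply: BA => /=.
exact: (qent_refl _ UB).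
Qed.

Fact pullback_split A :
  pullback_ent A -> exists2 B, pullback_ent B & B \; B `<=` A.
Proof.
move=> [C UC CA]; have [B UB BC] := qent_split UC.
exists [set p | B (f p.1, f p.2)]; first by exists B.
by move=> [x y] /= [z xz zy]; apply: CA; apply: BC; exists (f z).
Qed.

Definition pullback_qu :=
  QuasiUniformity pullback_filter pullback_diagonal pullback_split.

End Pullback.

Lemma left_universal (X : topologicalType) (G : paratopologicalGroupType)
    (f : X -> G) (N : set G) : continuous f -> nbhs 1%g N ->
  qent (universal_qu X) [set p | N ((f p.1)^-1 * f p.2)%g].
Proof.
move=> cf N1; apply: (@qent_universal _ (pullback_qu f (left_qu G)));
  last first.
  by exists [set p | N (p.1^-1 * p.2)%g] => //; exists N.
move=> A x [B [M M1 MB] BA].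
(* Inversion need not be continuous, but left translation by the fixed element [(f x)^-1] is: freeze
   the first factor of the product. *)
have Mx : nbhs (f x) [set y | M ((f x)^-1 * y)%g].
  have [[P Q] /= [Px Qx] PQM] :
      nbhs (((f x)^-1)%g, f x) [set p : G * G | M (p.1 * p.2)%g].
    by apply: mulg_continuous => /=; rewrite mulVg.
  apply: filterS Qx => y Qy.
  exact: (PQM ((f x)^-1%g, y) (conj (nbhs_singleton Px) Qy)).
have fxM : nbhs x [set y | M ((f x)^-1 * f y)%g] by exact: cf Mx.
by apply: filterS fxM => y My; apply/mem_set/BA/MB.
Qed.

(** * The paratopological group of real functions *)

Section UpperFun.
Variables (T : Type) (R : realType).

Definition upper_fun_ent : set_system ((T -> R) * (T -> R)) :=
  filter_from [set r : R | 0 < r]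
    (fun r => [set p | forall z, p.2 z < p.1 z + r]).

Fact upper_fun_filter : Filter upper_fun_ent.
Proof.
apply: filter_from_filter; first by exists 1; exact: ltr01.
move=> r s r0 s0; exists (Num.min r s); first by rewrite /= lt_min r0.
move=> p /= prs; split=> z; have := prs z; rewrite -!ltrBlDl lt_min.
all: by case/andP.
Qed.

Fact upper_fun_diagonal A : upper_fun_ent A -> diagonal `<=` A.
Proof.
move=> [r r0 rA]; apply: diagonal_subset => f; apply: rA => z.
by rewrite /= ltrDl.
Qed.

Fact upper_fun_split A :
  upper_fun_ent A -> exists2 B, upper_fun_ent B & B \; B `<=` A.
Proof.
move=> [r r0 rA]; exists [set p | forall z, p.2 z < p.1 z + r / 2].
  by exists (r / 2) => //=; rewrite divr_gt0.
move=> [f g] /= [h /= fh hg]; apply: rA => z /=.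
by have := fh z; have := hg z; lra.
Qed.

Definition upper_fun_qu :=
  QuasiUniformity upper_fun_filter upper_fun_diagonal upper_fun_split.

Definition upper_fun : Type := qu_space upper_fun_qu.

HB.instance Definition _ := Topological.on upper_fun.

HB.instance Definition _ := isGroup.Build upper_fun
  (@addrA (T -> R)) (@add0r (T -> R)) (@addr0 (T -> R))
  (@addNr (T -> R)) (@addrN (T -> R)).

Lemma nbhs_upper_fun (f : upper_fun) r : 0 < r ->
  nbhs f [set g : upper_fun | forall z, g z < f z + r].
Proof.
move=> r0; exists [set p | forall z, p.2 z < p.1 z + r]; first by exists r.
by move=> g /set_mem.
Qed.

Lemma nbhs_upper_funP (f : upper_fun) (A : set upper_fun) : nbhs f A ->
  exists2 r, 0 < r & forall g : upper_fun, (forall z, g z < f z + r) -> A g.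
Proof.
move=> [B [r r0 rB] BA]; exists r => // g gf; apply/BA/mem_set/rB.
exact: gf.
Qed.

Fact upper_fun_mul_continuous :
  continuous (fun p : upper_fun * upper_fun => (p.1 * p.2)%g).
Proof.
move=> [f g] A /nbhs_upper_funP[/= r r0 rA].
have r2 : 0 < r / 2 by rewrite divr_gt0.
exists ([set h : upper_fun | forall z, h z < f z + r / 2],
        [set h : upper_fun | forall z, h z < g z + r / 2]).
  by split; exact: nbhs_upper_fun.
move=> [f' g'] [/= ff' gg']; apply: rA => z; have := ff' z; have := gg' z.
rewrite -[(f * g)%g z]/(f z + g z) -[(f' * g')%g z]/(f' z + g' z).
by lra.
Qed.

HB.instance Definition _ :=
  isParatopologicalGroup.Build upper_fun upper_fun_mul_continuous.

End UpperFun.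

(** * Homomorphisms and embeddings *)

Lemma morph_invM (G H : groupType) (f : G -> H) x y :
  {morph f : x y / (x * y)%g} -> f (x^-1 * y)%g = ((f x)^-1 * f y)%g.
Proof. by move=> fM; rewrite -[in RHS](mulVKg x y) fM mulKg. Qed.

Lemma morph_one (G H : groupType) (f : G -> H) :
  {morph f : x y / (x * y)%g} -> f 1%g = 1%g.
Proof. by move=> fM; rewrite -(mulVg 1%g) morph_invM// mulVg. Qed.

Lemma embedding_continuous (S T : topologicalType) (f : S -> T) :
  topological_embedding f -> continuous f.
Proof.
move=> [_ openS]; apply/continuousP => B oB.
by rewrite openS; exists B.
Qed.

Lemma embedding_nbhs (S T : topologicalType) (f : S -> T) x (A : set S) :
  topological_embedding f -> nbhs x A ->
  exists2 B, nbhs (f x) B & f @^-1` B `<=` A.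
Proof.
move=> [_ openS]; rewrite nbhsE => -[C [+ Cx] CA].
rewrite openS => -[B oB BC]; exists B; last by rewrite BC.
by apply: open_nbhs_nbhs; split=> //; move: Cx; rewrite -BC.
Qed.

(** * Continuous quasi-pseudometrics and the Kuratowski map *)

Section QuasiPseudometric.
Variables (R : realType) (X : topologicalType) (d : X -> X -> R).
Hypothesis dqpm : is_quasi_pseudometric d.

(** Continuity is used at [(x, x)], where [d] vanishes, with the first coordinate then frozen; the
    second factor carries the topology of [X]. *)
Lemma qpm_continuous_nbhs x r : qpm_continuous d -> 0 < r ->
  nbhs x [set y | d x y < r].
Proof.
move=> dcont r0.
have dxx : nbhs (d x x : qu_space (upper_qu R)) [set t | t < r].
  exists [set p | p.2 < p.1 + r]; first by exists r.
  by move=> t /set_mem; rewrite /= (qpm_refl dqpm) add0r.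
have [[P Q] /= [Px Qx] PQ] := dcont (x, x) _ dxx.
have /inducesP <- := universal_qu_induces X.
apply: (filterS _ Qx) => y Qy.
exact: (PQ (x, y) (conj (nbhs_singleton Px) Qy)).
Qed.

(** The bound [d x' y' <= d x' x + d x y + d y y'] explains the two topologies: [d x' x] is small
    near [x] for the inverse quasi-uniformity, [d y y'] near [y] for the original one. *)
Lemma qent_qpm_continuous :
  (forall r, 0 < r -> qent (universal_qu X) [set p | d p.1 p.2 < r]) ->
  qpm_continuous d.
Proof.
move=> dU [x y] A [B [r r0 rB] BA].
have r2 : 0 < r / 2 by rewrite divr_gt0.
pose V := [set p | d p.1 p.2 < r / 2].
exists ([set x' | d x' x < r / 2], [set y' | d y y' < r / 2]).
  split.
    exists (V^-1)%relation; first by exists V => //; exact: dU.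
    by move=> x' /set_mem.
  by exists V; [exact: dU|move=> y' /set_mem].
move=> [x' y'] [/= xx' yy']; apply/BA/mem_set/rB => /=.
have := qpm_triangle dqpm x' y' x; have := qpm_triangle dqpm x y' y.
by lra.
Qed.

(* The Kuratowski map [x |-> d(., x)] turns [d] into the asymmetric sup-norm
   [sup_z (h z)^+] of a difference. *)
Lemma kuratowski_continuous : qpm_continuous d ->
  continuous (fun x => (fun z => d z x) : upper_fun X R).
Proof.
move=> dcont x A /nbhs_upper_funP[r r0 rA].
apply: (filterS _ (qpm_continuous_nbhs x dcont r0)) => y dxy.
apply: rA => z; have := qpm_triangle dqpm z y x; move: dxy => /=.
by lra.
Qed.

Lemma free_group_qpm_nbhs (FX : freeParatopologicalGroup X) r :
  qpm_continuous d -> 0 < r ->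
  exists2 N : set FX, nbhs 1%g N &
    forall x y, N ((fp_in FX x)^-1 * fp_in FX y)%g -> d x y < r.
Proof.
move=> dcont r0.
have [g [gM gcont] gE] := fp_extends FX (kuratowski_continuous dcont).
exists (g @^-1` [set h | forall z, h z < r]).
  apply: gcont; rewrite morph_one//.
  have := nbhs_upper_fun (1%g : upper_fun X R) r0.
  by apply: filterS => h /= hr z; rewrite -[r]add0r; exact: hr.
(* The image under [g] is the function [d(., y) - d(., x)]; its value at [x] is [d x y]. *)
move=> x y /= /(_ x); rewrite morph_invM// !gE.
rewrite -[X in X < _]/(- d x x + d x y).
by rewrite (qpm_refl dqpm) oppr0 add0r.
Qed.

End QuasiPseudometric.

(** * Traces of entourages, and density for the associated uniformity *)

Lemma natural_map_qpm_trace (R : realType) (Y : topologicalType) (X : set Y)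
    (FX : freeParatopologicalGroup X) (FY : freeParatopologicalGroup Y)
    (e : FX -> FY) (d : X -> X -> R) r :
  is_natural_map e -> topological_monomorphism e ->
  is_quasi_pseudometric d -> qpm_continuous d -> 0 < r ->
  exists2 B, qent (universal_qu Y) B &
    forall x y : X, B (set_val x, set_val y) -> d x y < r.
Proof.
move=> [_ eE] [eM eemb] dqpm dcont r0.
have [N N1 Nd] := free_group_qpm_nbhs dqpm FX dcont r0.
have [M M1 MN] := embedding_nbhs eemb N1.
rewrite morph_one// in M1.
eexists; first exact:
  left_universal (embedding_continuous (fp_in_embedding FY)) M1.
move=> x y /= Mxy; apply/Nd/MN => /=.
by rewrite morph_invM// !eE.
Qed.

(** If [B] is the trace of [C], then [C] intersected with its inverse is an entourage of the star
    uniformity, so density yields closeness in both directions. *)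
Lemma bicompletion_star_dense (T : Type) (U : quasiUniformity T)
    (T' : choiceType) (U' : quasiUniformity T') (j : T -> T') (A : set T)
    B y :
  is_bicompletion U U' j -> dense (j @` A : set (star_space U')) ->
  qent U B -> exists2 x, A x & B (y, x) /\ B (x, y).
Proof.
move=> bic dA; rewrite (bicompletion_trace bic) => -[C UC <-].
have SC : entourage (C `&` C^-1%relation : set (star_space U' * star_space U')).
  by apply/star_entE; exists C.
have yC : nbhs (j y : star_space U') (xsection (C `&` C^-1%relation) (j y)).
  exact: nbhs_entourage.
set yU : set (star_space U') := xsection _ _ in yC.
have [|z [yUz [x Ax xz]]] := dA _ _ (open_interior yU); first by exists (j y).
by exists x => //; move/interior_subset: yUz => /set_mem; rewrite -xz.
Qed.

(** * Extension of a quasi-pseudometric from a dense set *)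

Section Extension.
Variables (R : realType) (X Y : Type) (i : X -> Y) (U : quasiUniformity Y).
Variable d : X -> X -> R.
Hypothesis dqpm : is_quasi_pseudometric d.
Hypothesis dU : forall r, 0 < r ->
  exists2 B, qent U B & forall x x', B (i x, i x') -> d x x' < r.
Hypothesis iU : forall B y, qent U B -> exists x, B (y, i x) /\ B (i x, y).

Let star_close (B : set (Y * Y)) y x := B (y, i x) /\ B (i x, y).

Let star_closeS A B y x : A `<=` B -> star_close A y x -> star_close B y x.
Proof. by move=> AB [/AB ? /AB]. Qed.

(** Go from [x1] to [x2] through [y] and from [x2'] to [x1'] through [y']: each detour costs less
    than [r / 2], and each needs both directions of closeness. *)
Lemma close_qpm r : 0 < r -> exists2 B, qent U B &
  forall y y' x1 x2 x1' x2', star_close B y x1 -> star_close B y x2 ->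
    star_close B y' x1' -> star_close B y' x2' -> d x1 x1' < d x2 x2' + r.
Proof.
move=> r0; have r2 : 0 < r / 2 by rewrite divr_gt0.
have [A /qent_split[B UB BA] Ad] := dU r2.
exists B => // y y' x1 x2 x1' x2' [_ x1y] [yx2 _] [yx1' _] [_ x2y'].
have d1 : d x1 x2 < r / 2 by apply/Ad/BA; exists y.
have d2 : d x2' x1' < r / 2 by apply/Ad/BA; exists y'.
have := qpm_triangle dqpm x1 x1' x2; have := qpm_triangle dqpm x2 x1' x2'.
by lra.
Qed.

(* [d] is uniformly continuous for [U^*], so this upper limit of [d] at
   [(y, y')] is a limit. *)
Definition qpm_ext y y' := inf [set s | exists2 B, qent U B &
  forall x x', star_close B y x -> star_close B y' x' -> d x x' <= s].

(** This estimate, uniform in [y] and [y'], replaces the infimum in all that follows. *)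
Lemma qpm_ext_approx r : 0 < r -> exists2 B, qent U B &
  forall y y' x x', star_close B y x -> star_close B y' x' ->
    d x x' - r <= qpm_ext y y' <= d x x' + r.
Proof.
move=> r0; have [B UB Bd] := close_qpm r0.
exists B => // y y' x x' yx yx'; rewrite /qpm_ext.
set S := (S in inf S).
have Sd : S (d x x' + r).
  by exists B => // z z' yz yz'; apply/ltW/(Bd y y').
have dS : lbound S (d x x' - r).
  (* Approximants for both [B] and [C] link the bound [s], valid near [C], to [d x x'], controlled
     by [B]. *)
  move=> s [C UC Cs]; have UBC : qent U (B `&` C) by exact: filterI.
  have [z yz] := iU y UBC; have [z' yz'] := iU y' UBC.
  have /= := Cs _ _ (star_closeS (@subIsetr _ _ _) yz)
    (star_closeS (@subIsetr _ _ _) yz').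
  have := Bd y y' x z x' z' yx (star_closeS (@subIsetl _ _ _) yz) yx'
    (star_closeS (@subIsetl _ _ _) yz').
  by lra.
apply/andP; split; first by apply: lb_le_inf => //; exists (d x x' + r).
by apply: ge_inf => //; exists (d x x' - r).
Qed.

Lemma qpm_ext_qpm : is_quasi_pseudometric qpm_ext.
Proof.
split=> [y y'|y|y y' z].
- apply/ler_addgt0Pl => r r0; have [B UB Br] := qpm_ext_approx r0.
  have [x yx] := iU y UB; have [x' yx'] := iU y' UB.
  by have /andP[] := Br _ _ _ _ yx yx'; have := qpm_ge0 dqpm x x'; lra.
- apply/eqP; rewrite eq_le; apply/andP; split; apply/ler_addgt0Pl => r r0;
    have [B UB Br] := qpm_ext_approx r0; have [x yx] := iU y UB.
    by have := Br _ _ _ _ yx yx; rewrite (qpm_refl dqpm); lra.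
  by have := Br _ _ _ _ yx yx; rewrite (qpm_refl dqpm); lra.
(* Three values of the extension are approximated, each with error [r / 3]. *)
- apply/ler_addgt0Pl => r r0; have r3 : 0 < r / 3 by rewrite divr_gt0.
  have [B UB Br] := qpm_ext_approx r3.
  have [x yx] := iU y UB; have [x' yx'] := iU y' UB; have [t zt] := iU z UB.
  have := Br _ _ _ _ yx yx'; have := Br _ _ _ _ yx zt.
  have := Br _ _ _ _ zt yx'; have := qpm_triangle dqpm x x' t.
  by lra.
Qed.

Lemma qpm_extE x x' : qpm_ext (i x) (i x') = d x x'.
Proof.
have star_close_refl B z : qent U B -> star_close B (i z) z.
  by move=> UB; split; exact: (qent_refl _ UB).
apply/eqP; rewrite eq_le; apply/andP; split; apply/ler_addgt0Pl => r r0;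
  have [B UB Br] := qpm_ext_approx r0;
  have := Br _ _ _ _ (star_close_refl _ x UB) (star_close_refl _ x' UB); lra.
Qed.

Lemma qpm_ext_qent r : 0 < r -> qent U [set p | qpm_ext p.1 p.2 < r].
Proof.
move=> r0; have r2 : 0 < r / 2 by rewrite divr_gt0.
have [A /qent_split[C UC CA] Ad] := dU r2.
(* The chain from [i x] through [y] and [y'] to [i x'] has three links, so [A] is split twice; the
   fourth link is filled by reflexivity. *)
have [E UE EC] := qent_split UC.
have [B UB Br] := qpm_ext_approx r2.
apply: filterS (UE) => -[y y'] /= Eyy'.
have UBE : qent U (B `&` E) by exact: filterI.
have [x yx] := iU y UBE; have [x' yx'] := iU y' UBE.
have := Br _ _ _ _ (star_closeS (@subIsetl _ _ _) yx)
  (star_closeS (@subIsetl _ _ _) yx').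
suff : d x x' < r / 2 by lra.
case: yx yx' => [_ [_ Exy]] [[_ Eyx'] _].
apply/Ad/CA; exists y'; first by apply: EC; exists y.
by apply: EC; exists (i x') => //; exact: (qent_refl _ UE).
Qed.

End Extension.

Theorem theorem5p6 (R : realType) (Y : topologicalType) (X : set Y)
    (Yt : choiceType) (Ut : quasiUniformity Yt) (j : Y -> Yt)
    (FX : freeParatopologicalGroup X) (FY : freeParatopologicalGroup Y)
    (e : FX -> FY) :
  tychonoff_space Y ->
  is_bicompletion (universal_qu Y) Ut j ->
  dense (j @` X : set (star_space Ut)) ->
  is_natural_map e ->
  topological_monomorphism e ->
  quasi_P_embedded R X.
Proof.
move=> _ bic dX nat_e mono_e d dqpm dcont.
have dU r := @natural_map_qpm_trace _ _ _ _ _ _ _ r nat_e mono_e dqpm dcont.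
have iU B y : qent (universal_qu Y) B ->
    exists x : X, B (y, set_val x) /\ B (set_val x, y).
  move=> UB; have [x Xx Bx] := bicompletion_star_dense y bic dX UB.
  by exists (SigSub (mem_set Xx)).
(* With the universal quasi-uniformity of [Y] as [U], the entourages produced by the extension are
   those that give continuity. *)
exists (qpm_ext (fun x : X => set_val x) (universal_qu Y) d).
split=> [||x y]; first exact: qpm_ext_qpm.
- apply: qent_qpm_continuous; first exact: qpm_ext_qpm.
  by move=> r; exact: qpm_ext_qent.
- exact: qpm_extE.
Qed.
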